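(* In the hierarchical Poisson model described in the context, with depth $D\in\mathbb{N}$ and branching numbers $n_1,\dots,n_D\in\mathbb{N}$, let $D_0\in\{1,\dots,D\}$ and suppose that $n_D\ge2$. Then for any $D'=1,\dots,D$, under the entropy loss $\widetilde L^{\mathrm{KL}}$, the estimator $\hat\lambda^{(a^{(D_0)}(D_0))}(X(D'))$ is dominated by $\hat\lambda^{(a^{(D_0)}(D_0))}(X(D'-1))$. In particular, the Bayes estimator with respect to the Jeffreys prior and $X(D)$ is dominated by the Bayes estimator with respect to the Jeffreys prior and $X$.
   Context: Model. For $d=0,1,\dots,D$ let $I_d=\prod_{d'=1}^d\{1,\dots,n_{d'}\}$ ($I_0$ contains only the empty tuple). The unknown parameter is $\boldsymbol\lambda=(\lambda_{i_1,\dots,i_D})_{(i_1,\dots,i_D)\in I_D}\in(0,\infty)^{n_1\cdots n_D}$. For $(i_1,\dots,i_d)\in I_d$ put $\lambda_{(i_1,\dots,i_d)}=\sum_{i_{d+1}=1}^{n_{d+1}}\cdots\sum_{i_D=1}^{n_D}\lambda_{i_1,\dots,i_D}$; for $d=0$ this is the total $\lambda$. One observes independent variables $X=(X_{(i_1,\dots,i_d)})_{(i_1,\dots,i_d)\in I_d,\ d=0,\dots,D}$ with $X_{(i_1,\dots,i_d)}\sim\mathrm{Po}(\lambda_{(i_1,\dots,i_d)})$ (Poisson with that mean). For $D'=0,\dots,D$, $X(D')$ denotes the sub-collection with levels $d=D',\dots,D$ only; $X(0)=X$. Loss. For $\tilde d=(\tilde d_{i_1,\dots,i_D})\in(0,\infty)^{n_1\cdots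 n_D}$ with $\tilde d_{(i_1,\dots,i_d)}=\sum_{i_{d+1}}\cdots\sum_{i_D}\tilde d_{i_1,\dots,i_D}$, $$\widetilde L^{\mathrm{KL}}(\tilde d,\boldsymbol\lambda)=\sum_{d=0}^D\sum_{(i_1,\dots,i_d)\in I_d}\lambda_{(i_1,\dots,i_d)}\Big(\frac{\tilde d_{(i_1,\dots,i_d)}}{\lambda_{(i_1,\dots,i_d)}}-1-\log\frac{\tilde d_{(i_1,\dots,i_d)}}{\lambda_{(i_1,\dots,i_d)}}\Big).$$ An estimator $\delta$ is dominated by $\delta'$ if $E_{\boldsymbol\lambda}[\widetilde L^{\mathrm{KL}}(\delta',\boldsymbol\lambda)]\le E_{\boldsymbol\lambda}[\widetilde L^{\mathrm{KL}}(\delta,\boldsymbol\lambda)]$ for all $\boldsymbol\lambda$, with strict inequality for at least one $\boldsymbol\lambda$. Estimators. Let $\tilde X_{(i_1,\dots,i_d)}(D')=X_{(i_1,\dots,i_d)}$ if $d\ge D'$ and $0$ otherwise, and $\tilde X_{(i_1,\dots,i_d,+)}(D')=\sum_{d'=d}^D\sum_{i_{d+1}=1}^{n_{d+1}}\cdots\sum_{i_{d'}=1}^{n_{d'}}\tilde X_{(i_1,\dots,i_{d'})}(D')$ (for $d=0$ written $\tilde X_{(+)}(D')$). For $a=(a_0,\dots,a_D)\in(0,\infty)^{1+D}$, $\hat\lambda^{(a)}(X(D'))$ has $(i_1,\dots,i_D)$ component $$\frac{\tilde X_{(+)}(D')+a_0}{1+D-D'}\prod_{d=1}^D\frac{\tilde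 X_{(i_1,\dots,i_d,+)}(D')+a_d}{\sum_{i_d'=1}^{n_d}\tilde X_{(i_1,\dots,i_{d-1},i_d',+)}(D')+n_da_d}.$$ It is the generalized Bayes estimator, under $\widetilde L^{\mathrm{KL}}$ and based on $X(D')$, for the prior with density proportional to $\lambda^{a_0-1}\prod_{d=1}^D\prod_{(i_1,\dots,i_d)\in I_d}\theta_{(i_1,\dots,i_d)}^{a_d-1}$ in the coordinates $\lambda$ and $\theta_{(i_1,\dots,i_d)}=\lambda_{(i_1,\dots,i_d)}/\lambda_{(i_1,\dots,i_{d-1})}$. Hyperparameters. For $D_0\in\{1,\dots,D\}$ and $D'\in\{0,\dots,D_0\}$, $a^{(D_0)}(D')=(a_0,\dots,a_D)$ with $a_d=\frac12\prod_{d'=d+1}^D n_{d'}^{1(d'\le D'\text{ or }d'\ge D_0+1)}$ for $d=0,\dots,D_0-1$ and $a_d=\frac12\prod_{d'=d+1}^Dn_{d'}$ for $d=D_0,\dots,D$ (empty products equal $1$; $1(\cdot)$ is the indicator). In particular $a^{(D_0)}(D_0)=(\frac12 n_{d+1}\cdots n_D)_{d=0,\dots,D}$ for every $D_0$; this is the Jeffreys prior (the same for every $X(D')$), namely density proportional to $\lambda^{n_1\cdots n_D/2-1}\prod_{d=1}^D\prod_{(i_1,\dots,i_d)\in I_d}\theta_{(i_1,\dots,i_d)}^{n_{d+1}\cdots n_D/2-1}$. *)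

(* Defs.v *)
From HB Require Import structures.
From mathcomp Require Import all_boot all_order all_algebra.
From mathcomp Require Import all_classical all_reals all_analysis.

Set Implicit Arguments.
Unset Strict Implicit.
Unset Printing Implicit Defensive.
Import Order.TTheory GRing.Theory Num.Theory.
Local Open Scope classical_set_scope.
Local Open Scope ring_scope.

(* The branching numbers are [n 1, ..., n D]; the other values of [n] play no
   role.  A tuple (i_1, ..., i_d) is the dependent function sending [k : 'I_d]
   to i_(k+1), whose values are counted from 0 instead of 1. *)
Definition node (n : nat -> nat) (d : nat) : finType :=
  {dffun forall k : 'I_d, 'I_(n k.+1)}.

Definition trunc (n : nat -> nat) (d e : nat) (le_de : (d <= e)%N)
    (u : node n e) : node n d :=
  [ffun k : 'I_d => u (widen_ord le_de k) : 'I_(n k.+1)].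

(* [u] is of the form (v, i_(d+1), ..., i_e). *)
Definition extends (n : nat -> nat) (d e : nat) (v : node n d)
    (u : node n e) : bool :=
  (d <= e)%N &&
  [forall k : 'I_d, forall l : 'I_e, (k == l :> nat) ==> (v k == u l :> nat)].

Definition param (R : realType) (n : nat -> nat) (D : nat) : Type :=
  node n D -> R.

Definition positive (R : realType) (n : nat -> nat) (D : nat)
    (lam : param R n D) : Prop := forall i, 0 < lam i.

Definition marginal (R : realType) (n : nat -> nat) (D : nat)
    (lam : param R n D) (d : nat) (v : node n d) : R :=
  \sum_(i : node n D | extends v i) lam i.

Definition loss (R : realType) (n : nat -> nat) (D : nat)
    (dt lam : param R n D) : R :=
  \sum_(d < D.+1) \sum_(v : node n d)
    marginal lam v * (marginal dt v / marginal lam v - 1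
                      - ln (marginal dt v / marginal lam v)).

Definition data (n : nat -> nat) (D : nat) : Type :=
  forall d : 'I_D.+1, node n d -> nat.

Definition mutually_independent (disp : measure_display)
    (T : measurableType disp) (R : realType) (P : probability T R)
    (K : finType) (Y : K -> T -> nat) : Prop :=
  forall (J : {set K}) (A : K -> set nat),
    P [set w | forall k, k \in J -> A k (Y k w)]
    = (\prod_(k in J) P (Y k @^-1` A k))%E.

(* [P lam] is the law under the parameter [lam]; it is constrained only for
   positive [lam]. *)
Definition poisson_model (disp : measure_display) (T : measurableType disp)
    (R : realType) (n : nat -> nat) (D : nat)
    (P : param R n D -> probability T R)
    (X : forall d : 'I_D.+1, node n d -> {mfun T >-> nat}) : Prop :=
  forall lam : param R n D, positive lam ->
    mutually_independent (P lam)
      (fun v : {d : 'I_D.+1 & node n d} => X (tag v) (tagged v) : T -> nat) /\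
    forall (d : 'I_D.+1) (v : node n d) (k : nat),
      P lam (X d v @^-1` [set k]) = (poisson_pmf (marginal lam v) k)%:E.

Definition estimator (R : realType) (n : nat -> nat) (D : nat) : Type :=
  data n D -> param R n D.

Definition risk (disp : measure_display) (T : measurableType disp)
    (R : realType) (n : nat -> nat) (D : nat)
    (P : param R n D -> probability T R)
    (X : forall d : 'I_D.+1, node n d -> {mfun T >-> nat})
    (delta : estimator R n D) (lam : param R n D) : \bar R :=
  'E_(P lam)[fun w => loss (delta (fun d v => X d v w)) lam]%E.

Definition dominated (disp : measure_display) (T : measurableType disp)
    (R : realType) (n : nat -> nat) (D : nat)
    (P : param R n D -> probability T R)
    (X : forall d : 'I_D.+1, node n d -> {mfun T >-> nat})
    (delta delta' : estimator R n D) : Prop :=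
  (forall lam, positive lam -> (risk P X delta' lam <= risk P X delta lam)%E) /\
  (exists2 lam, positive lam & (risk P X delta' lam < risk P X delta lam)%E).

Definition xtilde (n : nat -> nat) (D D' : nat) (x : data n D)
    (d : 'I_D.+1) (v : node n d) : nat :=
  if (D' <= d)%N then x d v else 0%N.

Definition xplus (n : nat -> nat) (D D' : nat) (x : data n D)
    (d : nat) (v : node n d) : nat :=
  (\sum_(e < D.+1 | (d <= e)%N) \sum_(u : node n e | extends v u)
     xtilde D' x u)%N.

(* The generalized Bayes estimator based on X(D'), for the prior with density
   proportional to lambda^(a_0 - 1) * prod_(d, v in I_d) theta_v^(a_d - 1) in
   the coordinates lambda (the total) and theta_v = lambda_v / lambda_(parent
   of v).  Taking [jeffreys] for [a] gives the Jeffreys prior.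
   The product variable [d : 'I_D] stands for the level d + 1, and the sum in
   the denominator runs over the (i_1, ..., i_d, i') with i' arbitrary. *)
Definition bayes_est (R : realType) (n : nat -> nat) (D : nat)
    (a : nat -> R) (D' : nat) : estimator R n D :=
  fun x i =>
    ((xplus D' x (trunc (leq0n D) i))%:R + a 0%N) / (1 + D - D')%:R *
    \prod_(d < D)
      (((xplus D' x (trunc (ltn_ord d) i))%:R + a d.+1) /
       (\sum_(v : node n d.+1 | extends (trunc (ltnW (ltn_ord d)) i) v)
           (xplus D' x v)%:R
        + (n d.+1)%:R * a d.+1)).

Definition hyper (R : realType) (n : nat -> nat) (D D0 D' d : nat) : R :=
  if (d < D0)%N then
    2^-1 * \prod_(d.+1 <= e < D.+1)
             (n e)%:R ^+ ((e <= D')%N || (D0.+1 <= e)%N)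
  else 2^-1 * \prod_(d.+1 <= e < D.+1) (n e)%:R.

Definition jeffreys (R : realType) (n : nat -> nat) (D d : nat) : R :=
  (\prod_(d.+1 <= e < D.+1) n e)%:R / 2.

(* Main.v *)
(* Write m = 1 + D - D' and let N_v be the count X~_(v,+)(D').  For the Jeffreys
   hyperparameters, n_(d+1) a_(d+1) = a_d, so the product defining the estimator
   telescopes at the levels d <= D' to (N_v + a_d) / m, while the factors at
   deeper levels are the same for D' and D' - 1.  Hence the marginals of the
   two estimators delta (based on D') and delta' (based on D' - 1) have an
   explicit ratio.  The bound ln y <= y - 1 at y = delta_v / delta'_v gives
     loss delta' + sum_v (delta_v + lambda_v)
       <= loss delta + sum_v (delta'_v + lambda_v delta_v / delta'_v),
   and it remains to compare the expectations of the two sums, level by level.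
   This amounts to E[(N + a) / (N' + a)] < alpha / beta + a (beta - alpha) / beta^2,
   where N <= N' are sums of independent Poisson variables with means
   alpha < beta.  By the Stein identity E[X_u F(X)] = mu_u E[F(X + e_u)], it
   reduces to beta E[1 / (N' + a)] = E[N' / (N' - 1 + a)] < 1, which holds
   because a >= 1; this is where n_D >= 2 is needed.
   Finiteness of the risks is clear for D' = D, where delta_v >= a_d, and the
   same inequality propagates it down to smaller D'. *)
Require Import Defs.
From HB Require Import structures.
From mathcomp Require Import all_boot all_order all_algebra.
From mathcomp Require Import all_classical all_reals all_analysis.
From mathcomp Require Import measurable_realfun.
From mathcomp Require Import ring lra.

Set Implicit Arguments.
Unset Strict Implicit.
Unset Printing Implicit Defensive.
Import Order.TTheory GRing.Theory Num.Theory.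
Local Open Scope classical_set_scope.
Local Open Scope ring_scope.

(** * Expectations of functions of a finite family of counts *)

Definition config (K : finType) (T : Type) (Y : K -> T -> nat) (w : T) :
  {ffun K -> nat} := [ffun k => Y k w].

Definition shift (K : finType) (u : K) (x : {ffun K -> nat}) :
  {ffun K -> nat} := [ffun k => x k + (k == u)]%N.

Section Configurations.
Context (disp : measure_display) (T : measurableType disp) (R : realType).
Context (P : probability T R) (K : finType) (Y : K -> {mfun T >-> nat}).

Local Notation Z := (config (fun k => Y k : T -> nat)).

Definition mean (F : {ffun K -> nat} -> R) : \bar R :=
  (\int[P]_w (F (Z w))%:E)%E.

(** Configurations form a countable type, and the preimage of a single one is a finite intersection
    of events on the [Y k]. Hence every real function of the configuration is measurable. *)
Lemma measurable_config (S : set {ffun K -> nat}) : measurable (Z @^-1` S).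
Proof.
have mx x : measurable (Z @^-1` [set x]).
  have -> : Z @^-1` [set x] = \bigcap_(k in [set: K]) (Y k @^-1` [set x k]).
    apply/seteqP; split=> w /= => [<- k _|h]; first by rewrite /= ffunE.
    by apply/ffunP => k; rewrite ffunE h.
  apply: fin_bigcap_measurable => // k _; rewrite -[X in measurable X]setTI.
  exact: measurable_funPT.
have -> : Z @^-1` S = \bigcup_x (if x \in S then Z @^-1` [set x] else set0).
  apply/seteqP; split=> w /= => [Sw|[x _]].
    by exists (Z w) => //; rewrite mem_set.
  by case: ifPn => [/set_mem Sx /= -> //|].
apply: countable_bigcupT_measurable => [|x]; first exact: countableP.
by case: ifP.
Qed.

Lemma measurable_fun_config (F : {ffun K -> nat} -> R) (D : set T) :
  measurable D -> measurable_fun D (fun w => (F (Z w))%:E).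
Proof.
move=> mD; apply: measurable_funTS => _ S _; rewrite setTI.
exact: (measurable_config ((fun x => (F x)%:E) @^-1` S)).
Qed.

(** The sample space is cut into the events on which the configuration is constant, numbered by
    [pickle]; numbers outside the range of [pickle] give empty events. *)
Lemma mean_esum (F : {ffun K -> nat} -> R) : (forall x, 0 <= F x) ->
  mean F = \esum_(x in setT) ((F x)%:E * P (Z @^-1` [set x]))%E.
Proof.
move=> F0; pose C i := Z @^-1` (pickle @^-1` [set i]).
have mC i : measurable (C i) by exact: measurable_config.
have CT : \bigcup_i C i = setT.
  by apply/seteqP; split=> // w _; exists (pickle (Z w)).
have C_pickle x : C (pickle x) = Z @^-1` [set x].
  by apply/seteqP; split=> w; rewrite /C /=; [move/(pcan_inj pickleK)|move->].
have IC x : (\int[P]_(w in C (pickle x)) (F (Z w))%:E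
              = (F x)%:E * P (Z @^-1` [set x]))%E.
  rewrite -C_pickle -[RHS]integral_cst//; apply: eq_integral => w.
  by rewrite inE C_pickle => wx; congr (_%:E); rewrite -wx.
rewrite /mean -CT ge0_integral_bigcup//=; last 3 first.
- by rewrite CT; exact: measurable_fun_config.
- by move=> w _; rewrite lee_fin.
- by move=> i j _ _ [w [/= <- <-]].
rewrite nneseries_esumT => [|i]; last first.
  by apply: integral_ge0 => w _; rewrite lee_fin.
transitivity (\esum_(i in range (@pickle {ffun K -> nat}))
                (\int[P]_(w in C i) (F (Z w))%:E))%E.
  rewrite [RHS]esum_mkcond; apply: eq_esum => i _; case: ifPn => //.
  rewrite notin_setE => ni; rewrite (_ : C i = set0) ?integral_set0//.
  by rewrite -subset0 => w Cw; apply: ni; exists (Z w).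
rewrite esum_image; last by move=> x y _ _; exact: (pcan_inj pickleK).
by apply: eq_esum => x _; exact: IC.
Qed.

Lemma mean_ge0 (F : {ffun K -> nat} -> R) : (forall x, 0 <= F x) ->
  (0 <= mean F)%E.
Proof. by move=> F0; apply: integral_ge0 => w _; rewrite lee_fin. Qed.

Lemma mean_cst (c : R) : mean (fun=> c) = c%:E.
Proof. by rewrite /mean integral_cst//= probability_setT mule1. Qed.

Lemma le_mean (F G : {ffun K -> nat} -> R) : (forall x, 0 <= F x) ->
  (forall x, F x <= G x) -> (mean F <= mean G)%E.
Proof.
move=> F0 FG; apply: ge0_le_integral => //.
- by move=> w _; rewrite lee_fin.
- exact: measurable_fun_config.
- exact: measurable_fun_config.
- by move=> w _; rewrite lee_fin.
Qed.

Lemma meanD (F G : {ffun K -> nat} -> R) : (forall x, 0 <= F x) ->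
  (forall x, 0 <= G x) -> mean (fun x => F x + G x) = (mean F + mean G)%E.
Proof.
move=> F0 G0; rewrite /mean -ge0_integralD//=.
- by move=> w _; rewrite lee_fin.
- exact: measurable_fun_config.
- by move=> w _; rewrite lee_fin.
- exact: measurable_fun_config.
Qed.

Lemma meanZ (c : R) (F : {ffun K -> nat} -> R) : 0 <= c ->
  (forall x, 0 <= F x) -> mean (fun x => c * F x) = (c%:E * mean F)%E.
Proof.
move=> c0 F0; rewrite /mean -ge0_integralZl_EFin//.
- by move=> w _; rewrite lee_fin.
- exact: measurable_fun_config.
Qed.

Lemma mean_sum (I : Type) (s : seq I) (Q : pred I)
    (F : I -> {ffun K -> nat} -> R) : (forall i x, Q i -> 0 <= F i x) ->
  mean (fun x => \sum_(i <- s | Q i) F i x) = (\sum_(i <- s | Q i) mean (F i))%E.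
Proof.
move=> F0; elim: s => [|i s IHs].
  by under eq_fun do rewrite big_nil; rewrite big_nil mean_cst.
under eq_fun do rewrite big_cons; rewrite big_cons.
case: ifPn => // Qi; rewrite meanD ?IHs// => x; first exact: F0.
by apply: sumr_ge0 => j; exact: F0.
Qed.

End Configurations.

(** * The Stein identity and the ratio bound for independent Poisson counts *)

Section Poisson_configurations.
Context (disp : measure_display) (T : measurableType disp) (R : realType).
Context (P : probability T R) (K : finType) (Y : K -> {mfun T >-> nat}).
Context (mu : K -> R) (mu_gt0 : forall k, 0 < mu k).
Context (Yindep : mutually_independent P (fun k => Y k : T -> nat)).
Context (Ypoisson : forall k j,
  P (Y k @^-1` [set j]) = (poisson_pmf (mu k) j)%:E).

Local Notation Z := (config (fun k => Y k : T -> nat)).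
Local Notation E := (mean P Y).

Lemma config_pmf x :
  P (Z @^-1` [set x]) = (\prod_k poisson_pmf (mu k) (x k))%:E.
Proof.
have := Yindep [set: K]%SET (fun k => [set x k]).
rewrite (_ : [set w | _] = Z @^-1` [set x]); last first.
  apply/seteqP; split=> w /= => [h|<- k _]; last by rewrite ffunE.
  by apply/ffunP => k; rewrite ffunE h ?inE.
move=> ->; rewrite -prodEFin; apply: eq_big => [k|k _]; first by rewrite inE.
exact: Ypoisson.
Qed.

(** Only the factor at [u] changes, and there (j + 1) p(j + 1) = mu p(j) for the Poisson weights. *)
Lemma config_pmf_shift u (x : {ffun K -> nat}) :
  (shift u x u)%:R * \prod_k poisson_pmf (mu k) (shift u x k)
  = mu u * \prod_k poisson_pmf (mu k) (x k).
Proof.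
rewrite (bigD1 u)//= [in RHS](bigD1 u)//= !mulrA; congr (_ * _); last first.
  by apply: eq_bigr => k /negPf ku; rewrite !ffunE ku addn0.
rewrite !ffunE eqxx addn1 /poisson_pmf mu_gt0 factS natrM exprS.
have := fact_gt0 (x u); rewrite -(ltr_nat R) => fx.
by field; rewrite !gt_eqF// nmulrn ltr0n.
Qed.

(** Configurations with [x u = 0] contribute nothing to the left side; the others are exactly the
    range of the injective map [shift u], so the sum can be reindexed along it. Nonnegativity of [F]
    replaces integrability. *)
Lemma stein u (F : {ffun K -> nat} -> R) : (forall x, 0 <= F x) ->
  E (fun x => (x u)%:R * F x) = ((mu u)%:E * E (fun x => F (shift u x)))%E.
Proof.
move=> F0; rewrite -meanZ//; last exact: ltW.
rewrite !mean_esum; last 2 first.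
- by move=> x; rewrite mulr_ge0// ltW.
- by move=> x; rewrite mulr_ge0.
transitivity (\esum_(x in range (shift u))
    ((x u)%:R * F x)%:E * P (Z @^-1` [set x]))%E.
  rewrite [RHS]esum_mkcond; apply: eq_esum => x _; case: ifPn => //.
  rewrite notin_setE => nx; suff -> : x u = 0%N by rewrite mul0r mul0e.
  apply/eqP; rewrite -leqn0 leqNgt; apply/negP => xu; apply: nx.
  exists [ffun k => x k - (k == u)]%N => //; apply/ffunP => k; rewrite !ffunE.
  by case: eqVneq => [->|_]; rewrite ?subn0 ?addn0// subnK.
rewrite esum_image => [|x y _ _ /ffunP xy]; last first.
  by apply/ffunP => k; have := xy k; rewrite !ffunE => /addIn.
apply: eq_esum => x _; rewrite !config_pmf -!EFinM; congr (_%:E).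
by rewrite mulrAC config_pmf_shift; ring.
Qed.

(** Since A lies in B, adding one to any coordinate of A raises the total over B by one, so the
    Stein identities for all [k] in A share the same right-hand expectation. *)
Lemma stein_sum (A B : {set K}) (f : nat -> R) : (A \subset B)%SET ->
    (forall j, 0 <= f j) ->
  E (fun x => (\sum_(k in A) x k)%:R * f (\sum_(k in B) x k)%N)
  = ((\sum_(k in A) mu k)%:E * E (fun x => f (\sum_(k in B) x k).+1))%E.
Proof.
move=> AB f0.
under [X in mean _ _ X]eq_fun do rewrite natr_sum mulr_suml.
rewrite mean_sum => [|k x _]; last by rewrite mulr_ge0.
rewrite -sumEFin ge0_sume_distrl => [|k _]; last by rewrite lee_fin ltW.
apply: eq_bigr => k kA; rewrite stein//; congr (_ * _)%E.
congr mean; apply/funext => x; congr f; have kB := fintype.subsetP AB k kA.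
rewrite (bigD1 k)//= [in RHS](bigD1 k)//= ffunE eqxx addn1 addSn.
congr ((_ + _).+1)%N; apply: eq_bigr => j /andP[_ /negPf jk].
by rewrite ffunE jk addn0.
Qed.

Lemma mean_count (A : {set K}) :
  E (fun x => (\sum_(k in A) x k)%:R) = (\sum_(k in A) mu k)%:E.
Proof.
have := @stein_sum A A (fun=> 1) (subxx _) (fun=> ler01).
by rewrite mean_cst mule1; under eq_fun do rewrite mulr1.
Qed.

(** The positive mass of the zero configuration is the source of strictness in the ratio bound. *)
Lemma mean_config0_gt0 : (0 < E (fun x => (x == [ffun=> 0%N])%:R))%E.
Proof.
have -> : E (fun x => (x == [ffun=> 0%N])%:R) = P (Z @^-1` [set [ffun=> 0%N]]).
  rewrite -[in RHS](setIT (_ @^-1` _)) -integral_indic//; last first.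
    exact: measurable_config.
  apply: eq_integral => w _; rewrite indicE; congr ((nat_of_bool _)%:R%:E).
  by apply/eqP/idP => [h|/set_mem//]; exact/mem_set.
rewrite config_pmf lte_fin prodr_gt0// => k _.
by rewrite /poisson_pmf mu_gt0 mulr_gt0 ?expR_gt0// divr_gt0 ?exprn_gt0// ltr0n
  fact_gt0.
Qed.

Lemma mean_fin (F : {ffun K -> nat} -> R) (c : R) :
  (forall x, 0 <= F x <= c) -> exists2 r, 0 <= r & E F = r%:E.
Proof.
move=> Fc; have F0 x : 0 <= F x by have /andP[] := Fc x.
exists (fine (E F)); first by rewrite fine_ge0// mean_ge0.
rewrite fineK// ge0_fin_numE ?mean_ge0//.
apply: (@le_lt_trans _ _ (E (fun=> c))); last by rewrite mean_cst ltry.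
by apply: le_mean => // x; have /andP[] := Fc x.
Qed.

(** With q = E[1 / (N' + a)] and r = E[1 / (N' + 1 + a)], the Stein identity turns the expectation
    into alpha r + a q. Eliminating r leaves a bound that is strict as soon as beta q < 1. *)
Lemma mean_ratio_lt (A B : {set K}) (a alpha beta : R) : (A \subset B)%SET ->
    \sum_(k in A) mu k = alpha -> \sum_(k in B) mu k = beta ->
    1 <= a -> alpha < beta ->
  (E (fun x => (((\sum_(k in A) x k)%N%:R + a) / ((\sum_(k in B) x k)%N%:R + a))%R)
   < (alpha / beta + a * (beta - alpha) / beta ^+ 2)%:E)%E.
Proof.
move=> AB eA eB a1 ab.
have a0 : 0 < a by exact: lt_le_trans a1.
have alpha0 : 0 <= alpha by rewrite -eA; apply: sumr_ge0 => k _; exact: ltW.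
have beta0 : 0 < beta by exact: le_lt_trans ab.
have den0 (j : nat) : 0 < j%:R + a by rewrite ltr_wpDl.
have inv0 (j : nat) : 0 <= (j%:R + a)^-1 by rewrite invr_ge0 ltW.
have inv1 (j : nat) : (j%:R + a)^-1 <= 1.
  by rewrite invf_le1// (le_trans a1)// lerDr.
have [q q0 Eq] : exists2 q, 0 <= q &
    E (fun x => ((\sum_(k in B) x k)%:R + a)^-1) = q%:E.
  by apply: (@mean_fin _ 1) => x; rewrite inv0 inv1.
have [r r0 Er] : exists2 r, 0 <= r &
    E (fun x => ((\sum_(k in B) x k).+1%:R + a)^-1) = r%:E.
  by apply: (@mean_fin _ 1) => x; rewrite inv0 inv1.
have split_ratio (C : {set K}) : (C \subset B)%SET ->
    E (fun x => ((\sum_(k in C) x k)%:R + a) / ((\sum_(k in B) x k)%:R + a))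
    = ((\sum_(k in C) mu k) * r + a * q)%:E.
  move=> CB; under [X in mean _ _ X]eq_fun do rewrite mulrDl.
  rewrite meanD; last 2 first.
  - by move=> x; rewrite mulr_ge0.
  - by move=> x; rewrite mulr_ge0// ltW.
  rewrite meanZ ?(ltW a0)// Eq (stein_sum (f := fun j => (j%:R + a)^-1))//.
  by rewrite Er.
(* For C = B the ratio is identically 1, which gives a linear relation between q and r. *)
have qr : beta * r + a * q = 1.
  apply: EFin_inj; rewrite -eB -split_ratio// -[RHS](mean_cst P Y).
  by congr mean; apply/funext => x; rewrite divff// gt_eqF.
(* By Stein, beta q = E[N' / (N' - 1 + a)]. The integrand is at most 1 because a >= 1, and it
   vanishes at the zero configuration, so the mass p of that point is lost. The truncated
   predecessor at 0 is harmless, being multiplied by 0. *)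
have qlt : beta * q < 1.
  have [p p0 Ep] : exists2 p, 0 <= p & E (fun x => (x == [ffun=> 0%N])%:R) = p%:E.
    by apply: (@mean_fin _ 1) => x; rewrite ler0n lern1 leq_b1.
  have : 0 < p by rewrite -lte_fin -Ep mean_config0_gt0.
  suff: beta * q + p <= 1 by lra.
  have := @stein_sum B B (fun j => (j.-1%:R + a)^-1) (subxx _) (fun j => inv0 _).
  rewrite [X in (_ * X)%E]Eq eB -lee_fin EFinD EFinM => <-; rewrite -Ep -meanD//.
  - rewrite -(mean_cst P Y); apply: le_mean => x; first by rewrite addr_ge0 ?mulr_ge0.
    have [->|_] := eqVneq x.
      by rewrite big1 ?mul0r ?add0r// => k _; rewrite ffunE.
    rewrite addr0 ler_pdivrMr// mul1r; case: (\sum_(k in B) x k)%N => [|j] /=.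
      by rewrite addr_ge0// ltW.
    by rewrite -addn1 natrD lerD2l.
  - by move=> x; rewrite mulr_ge0.
rewrite split_ratio// lte_fin eA.
have -> : r = (1 - a * q) / beta by rewrite -qr; field; rewrite gt_eqF.
have -> : alpha * ((1 - a * q) / beta) + a * q
  = alpha / beta + a * (beta - alpha) / beta ^+ 2 * (beta * q).
  by field; rewrite gt_eqF.
rewrite ltrD2l gtr_pMr// divr_gt0 ?exprn_gt0// mulr_gt0// subr_gt0//.
Qed.

End Poisson_configurations.

(** * Combinatorics of the tree of index tuples *)

Section Tree.
Context (n : nat -> nat).

Lemma node_val d (u : node n d) (k l : 'I_d) : k = l :> nat ->
  u k = u l :> nat.
Proof. by move/val_inj => ->. Qed.

Lemma extendsE d e (le_de : (d <= e)%N) (v : node n d) (u : node n e) :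
  extends v u = (trunc le_de u == v).
Proof.
rewrite /extends le_de /=; apply/'forall_forallP/eqP => [vu|<- k l].
  by apply/ffunP => k; rewrite ffunE; apply/val_inj/esym/eqP; apply: (implyP (vu _ _)).
apply/implyP => /eqP kl; rewrite ffunE; apply/eqP; exact: node_val.
Qed.

Lemma trunc_id d (le_dd : (d <= d)%N) (u : node n d) : trunc le_dd u = u.
Proof. by apply/ffunP => k; rewrite ffunE; apply/val_inj/node_val. Qed.

Lemma trunc_trunc c d e (le_cd : (c <= d)%N) (le_de : (d <= e)%N)
    (le_ce : (c <= e)%N) (u : node n e) :
  trunc le_cd (trunc le_de u) = trunc le_ce u.
Proof. by apply/ffunP => k; rewrite !ffunE; apply/val_inj/node_val. Qed.

Lemma extends_refl d (v u : node n d) : extends v u = (u == v).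
Proof. by rewrite (extendsE (leqnn d)) trunc_id. Qed.

Lemma extends_root d (v : node n 0) (u : node n d) : extends v u.
Proof. by rewrite (extendsE (leq0n d)); apply/eqP/ffunP => -[]. Qed.

Lemma big_extends (S : Type) (idx : S) (op : Monoid.com_law idx) c d e
    (v : node n c) (F : node n e -> S) : (c <= d <= e)%N ->
  \big[op/idx]_(u : node n e | extends v u) F u =
  \big[op/idx]_(w : node n d | extends v w)
    \big[op/idx]_(u : node n e | extends w u) F u.
Proof.
move=> /andP[le_cd le_de]; have le_ce := leq_trans le_cd le_de.
rewrite (partition_big (trunc le_de) (extends v)) => [|u]; last first.
  by rewrite (extendsE le_ce) (extendsE le_cd) (trunc_trunc _ _ le_ce).
apply: eq_bigr => w; rewrite (extendsE le_cd) => /eqP <-.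
apply: eq_bigl => u; rewrite (extendsE le_de) (extendsE le_ce).
by case: (trunc le_de u =P w) => [<-|_]; rewrite ?(trunc_trunc _ _ le_ce) ?eqxx ?andbT ?andbF.
Qed.

Lemma big_level (S : Type) (idx : S) (op : Monoid.com_law idx) d e
    (F : node n e -> S) : (d <= e)%N ->
  \big[op/idx]_(u : node n e) F u =
  \big[op/idx]_(w : node n d) \big[op/idx]_(u : node n e | extends w u) F u.
Proof.
move=> le_de; rewrite (partition_big (trunc le_de) xpredT)//.
by apply: eq_bigr => w _; apply: eq_bigl => u; rewrite (extendsE le_de).
Qed.

(** The type of coordinate [k] depends on [k], so the appended index [i] is transported along the
    equality [d = k] that follows when [k < d] fails. *)
Definition child d (v : node n d) (i : 'I_(n d.+1)) : node n d.+1 :=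
  [ffun k : 'I_d.+1 =>
     match @idP (k < d)%N with
     | ReflectT lt_kd => v (Ordinal lt_kd)
     | ReflectF ge_kd =>
       cast_ord (congr1 (fun j => n j.+1)
         (esym (anti_leq (introT andP (conj (ltn_ord k : (k <= d)%N)
            (etrans (leqNgt d k) (introT negP ge_kd))))))) i
     end : 'I_(n k.+1)].

Lemma val_child d (v : node n d) (i : 'I_(n d.+1)) (k : 'I_d.+1) :
  child v i k = (if insub (k : nat) is Some k' then v k' else i) :> nat.
Proof.
rewrite ffunE; case: {-}_ / idP => [lt_kd|/negP ge_kd] /=.
  by rewrite insubT.
by rewrite insubN.
Qed.

Lemma extends_child d (v : node n d) (i : 'I_(n d.+1)) :
  extends v (child v i).
Proof.
rewrite (extendsE (leqnSn d)); apply/eqP/ffunP => k; rewrite ffunE.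
apply: val_inj; apply: etrans (val_child v i (widen_ord (leqnSn d) k)) _ => /=.
by rewrite (insubT (fun j => j < d)%N (ltn_ord k)) /=; exact: node_val.
Qed.

(** The map [child v] is injective, as its last coordinate recovers the index, and its image
    consists of the nodes extending [v]. *)
Lemma card_children d (v : node n d) :
  #|[pred u : node n d.+1 | extends v u]| = n d.+1.
Proof.
have inj_child : injective (child v).
  move=> i j /(congr1 (fun u : node n d.+1 => u ord_max : nat)).
  by rewrite !val_child insubN /= ?ltnn// => /val_inj.
rewrite -[RHS]card_ord -(card_codom inj_child).
apply: eq_card => u; rewrite inE.
apply/idP/codomP => [|[i ->]]; last exact: extends_child.
rewrite (extendsE (leqnSn d)) => /eqP uv.
exists (u ord_max); apply/ffunP => k; apply: val_inj; rewrite /= val_child.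
case: insubP => [k' _ kk'|]; first by rewrite -uv ffunE; exact: node_val.
rewrite -leqNgt => le_dk; apply: node_val.
by apply/eqP; rewrite eqn_leq le_dk -ltnS ltn_ord.
Qed.

Lemma sum_children (R : pzSemiRingType) d (v : node n d) (c : R) :
  \sum_(u : node n d.+1 | extends v u) c = (n d.+1)%:R * c.
Proof. by rewrite sumr_const (eq_card (B := [pred u | extends v u])) ?card_children ?mulr_natl. Qed.

Lemma node_inhabited D d : (forall k, (1 <= k <= D)%N -> (0 < n k)%N) ->
  (d <= D)%N -> inhabited (node n d).
Proof.
move=> n_gt0; elim: d => [_|d IHd dD].
  by apply: inhabits; apply: ffun0; rewrite card_ord.
have [v] := IHd (ltnW dD).
by apply: inhabits; exact: child v (Ordinal (n_gt0 d.+1 dD)).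
Qed.

End Tree.

(** * Marginals of the parameter and the counts seen from a node *)

Section Marginals.
Context (R : realType) (n : nat -> nat) (D : nat).

Lemma marginal_sum (f : param R n D) c d (v : node n c) : (c <= d <= D)%N ->
  \sum_(u : node n d | extends v u) marginal f u = marginal f v.
Proof. by move=> cdD; rewrite /marginal -big_extends. Qed.

Lemma marginal_level (f : param R n D) d : (d <= D)%N ->
  \sum_(u : node n d) marginal f u = \sum_i f i.
Proof. by move=> dD; rewrite /marginal -big_level. Qed.

Lemma marginal_root (f : param R n D) (v : node n 0) :
  marginal f v = \sum_i f i.
Proof. by apply: eq_bigl => i; rewrite extends_root. Qed.

Lemma marginal_leaf (f : param R n D) (v : node n D) : marginal f v = f v.
Proof.
by rewrite /marginal (eq_bigl (pred1 v)) ?big_pred1_eq// => i; rewrite extends_refl.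
Qed.

(** Induction on the distance D - d to the leaves; positive branching numbers guarantee that each
    inner node has a child. *)
Lemma marginal_gt0 (lam : param R n D) d (v : node n d) :
    (forall k, (1 <= k <= D)%N -> (0 < n k)%N) -> positive lam ->
  (d <= D)%N -> 0 < marginal lam v.
Proof.
move=> n_gt0 lam_gt0 /subnKC; move: (D - d)%N => k.
elim: k d v => [|k IHk] d v.
  by rewrite addn0 => dD; subst d; rewrite marginal_leaf.
move=> dD; have dD' : (d < D)%N by rewrite -dD -addSnnS leq_addr.
have nd : (0 < n d.+1)%N by rewrite n_gt0.
rewrite -(marginal_sum lam (d := d.+1)) ?leqnSn//.
rewrite (bigD1 (child v (Ordinal nd)))/=; last exact: extends_child.
rewrite ltr_wpDr ?IHk ?addSnnS// sumr_ge0// => u _.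
by rewrite ltW// IHk// addSnnS.
Qed.

(** Above the first observed level the node's own observation is replaced by 0, so its count is
    carried entirely by its children. *)
Lemma xplus_children D' (x : data n D) d (v : node n d) :
    (d < D)%N -> (d < D')%N ->
  (\sum_(u : node n d.+1 | extends v u) xplus D' x u)%N = xplus D' x v.
Proof.
move=> dD dD'; rewrite /xplus exchange_big/= big_mkcond [RHS]big_mkcond/=.
apply: eq_bigr => e _; case: ltngtP => // [de|de].
  by rewrite -big_extends// de leqnSn.
by rewrite big1// => u _; rewrite /xtilde -de leqNgt dD'.
Qed.

Lemma xplus_pred c (x : data n D) d (v : node n d) : (c < d)%N ->
  xplus c.+1 x v = xplus c x v.
Proof.
move=> cd; apply: eq_bigr => e de; apply: eq_bigr => u _.
by rewrite /xtilde (leq_trans cd de) (leq_trans (ltnW cd) de).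
Qed.

Definition node_index : finType := {d : 'I_D.+1 & node n d}.

(** Writes a count as a sum over a set of independent coordinates; these are the sets A and B to
    which the ratio bound is applied. *)
Definition observed D' d (v : node n d) : {set node_index} :=
  [set k : node_index | [&& D' <= tag k, d <= tag k & extends v (tagged k)]%N].

Definition data_of (z : {ffun node_index -> nat}) : data n D :=
  fun d v => z (Tagged (fun d : 'I_D.+1 => node n d) v).

Lemma xplus_observed D' z d (v : node n d) :
  xplus D' (data_of z) v = (\sum_(k in observed D' v) z k)%N.
Proof.
rewrite /xplus sig_big_dep big_mkcond [RHS]big_mkcond/=.
apply: eq_bigr => -[e u] _; rewrite inE /= /xtilde /data_of /=.
by case: (D' <= e)%N => //=; case: ifP.
Qed.

Lemma observedS c d (v : node n d) : observed c.+1 v \subset observed c v.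
Proof.
by apply/fintype.subsetP => k; rewrite !inE => /and3P[/ltnW -> -> ->].
Qed.

(** Each of the D + 1 - D' observed levels contributes [marginal lam v] once. *)
Lemma sum_observed (lam : param R n D) D' d (v : node n d) :
    (d <= D')%N ->
  \sum_(k in observed D' v) marginal lam (tagged k)
  = (D.+1 - D')%:R * marginal lam v.
Proof.
move=> dD'; transitivity (\sum_(e < D.+1 | (D' <= e)%N)
    \sum_(u : node n e | extends v u) marginal lam u).
  rewrite [RHS]sig_big_dep /=; apply: eq_big => // k; rewrite inE.
  by case: leqP => //= /(leq_trans dD') ->.
under eq_bigr => e De.
  rewrite marginal_sum; last by rewrite (leq_trans dD' De) -ltnS ltn_ord.
  over.
by rewrite -(big_geq_mkord _ _ xpredT (fun=> marginal lam v)) sumr_const_nat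
  mulr_natl.
Qed.

End Marginals.

(** * Marginals of the Bayes estimator as partial products of its formula *)

Definition partial_est (R : realType) (n : nat -> nat) (D : nat) (a : nat -> R)
    (D' : nat) (x : data n D) (d : nat) (v : node n d) : R :=
  ((xplus D' x (trunc (leq0n d) v))%:R + a 0%N) / (1 + D - D')%:R *
  \prod_(k < d)
    (((xplus D' x (trunc (ltn_ord k) v))%:R + a k.+1) /
     (\sum_(u : node n k.+1 | extends (trunc (ltnW (ltn_ord k)) v) u)
         (xplus D' x u)%:R
      + (n k.+1)%:R * a k.+1)).

Section Bayes_estimator.
Context (R : realType) (n : nat -> nat) (D : nat) (a : nat -> R).
Context (a_gt0 : forall d, (d <= D)%N -> 0 < a d).
Context (a_children : forall d, (d < D)%N -> (n d.+1)%:R * a d.+1 = a d).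
Implicit Types (x : data n D).

Lemma partial_estS D' x d (u : node n d.+1) (v := trunc (leqnSn d) u) :
  partial_est a D' x u = partial_est a D' x v *
    (((xplus D' x u)%:R + a d.+1) /
     (\sum_(c : node n d.+1 | extends v c) (xplus D' x c)%:R
      + (n d.+1)%:R * a d.+1)).
Proof.
rewrite /partial_est big_ord_recr /= mulrA; congr (_ * _ * _).
- by rewrite (trunc_trunc _ _ (leq0n _)).
- apply: eq_bigr => k _ /=.
  rewrite (trunc_trunc _ _ (ltn_ord (widen_ord (leqnSn d) k))).
  by rewrite (trunc_trunc _ _ (ltnW (ltn_ord (widen_ord (leqnSn d) k)))).
- congr (((xplus D' x _)%:R + _) / (_ + _)); first exact: trunc_id.
  by apply: eq_bigl => c; congr (extends _ c); apply/ffunP => k; rewrite !ffunE;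
    apply/val_inj/node_val.
Qed.

Lemma den_gt0 D' x d (v : node n d) : (d < D)%N ->
  0 < \sum_(c : node n d.+1 | extends v c) (xplus D' x c)%:R
      + (n d.+1)%:R * a d.+1.
Proof.
by move=> dD; rewrite a_children// ltr_wpDl ?sumr_ge0// a_gt0// ltnW.
Qed.

Lemma partial_est_gt0 D' x d (v : node n d) : (D' <= D)%N -> (d <= D)%N ->
  0 < partial_est a D' x v.
Proof.
move=> D'D; elim: d v => [|d IHd] v dD.
  by rewrite /partial_est big_ord0 mulr1 divr_gt0 ?ltr_wpDl ?a_gt0// ltr0n subn_gt0.
rewrite partial_estS mulr_gt0 ?IHd//; first exact: ltnW.
by rewrite divr_gt0 ?den_gt0// ltr_wpDl// a_gt0.
Qed.

(** The new factors are estimated conditional proportions, which sum to 1 over the children. *)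
Lemma partial_est_children D' x d (v : node n d) : (d < D)%N ->
  \sum_(u : node n d.+1 | extends v u) partial_est a D' x u
  = partial_est a D' x v.
Proof.
move=> dD; under eq_bigr => u.
  by rewrite (extendsE (leqnSn d)) partial_estS => /eqP ->; over.
rewrite -mulr_sumr -mulr_suml big_split /= sum_children divff ?mulr1//.
by rewrite gt_eqF// den_gt0.
Qed.

(** At a leaf the partial product is the whole estimator; going up, both sides are sums over
    children. *)
Lemma marginal_bayes_est D' x d (v : node n d) : (d <= D)%N ->
  marginal (bayes_est a D' x) v = partial_est a D' x v.
Proof.
move=> /subnKC; move: (D - d)%N => k; elim: k d v => [|k IHk] d v.
  by rewrite addn0 => dD; subst d; rewrite marginal_leaf.
move=> dD; have dD' : (d < D)%N by rewrite -dD -addSnnS leq_addr.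
rewrite -partial_est_children// -(marginal_sum _ (d := d.+1)) ?leqnSn//.
by apply: eq_bigr => u _; rewrite IHk// addSnnS.
Qed.

(* Above the first observed level the product telescopes, because the counts
   of the children add up to the count of the parent. *)
Lemma partial_est_telescope D' x d (v : node n d) : (d <= D')%N -> (d <= D)%N ->
  partial_est a D' x v = ((xplus D' x v)%:R + a d) / (1 + D - D')%:R.
Proof.
elim: d v => [|d IHd] v dD' dD.
  by rewrite /partial_est big_ord0 mulr1 trunc_id.
rewrite partial_estS IHd ?(ltnW dD') ?(ltnW dD)// -natr_sum xplus_children//.
rewrite a_children// mulrC mulrA divfK// gt_eqF// ltr_wpDl// a_gt0//.
exact: ltnW.
Qed.

(** The quotient of the telescoped marginals based on X(c + 1) and on X(c), for a node at level at
    most c. *)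
Definition est_ratio c x d (v : node n d) : R :=
  (1 + D - c)%:R / (D - c)%:R *
  (((xplus c.+1 x v)%:R + a d) / ((xplus c x v)%:R + a d)).

Lemma partial_est_ratio_above c x d (v : node n d) : (d <= c)%N -> (c < D)%N ->
  partial_est a c.+1 x v = est_ratio c x v * partial_est a c x v.
Proof.
move=> dc cD; have dD := leq_trans dc (ltnW cD).
rewrite !partial_est_telescope ?leqW// /est_ratio add1n subSS.
have : 0 < (xplus c x v)%:R + a d by rewrite ltr_wpDl// a_gt0.
have : 0 < (D - c)%:R :> R by rewrite ltr0n subn_gt0.
have : 0 < (D.+1 - c)%:R :> R by rewrite ltr0n subn_gt0 ltnW.
by move=> h1 h2 h3; field; rewrite !gt_eqF.
Qed.

(** Counts at levels beyond c do not involve the observations of level c, so the deeper factors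
    agree and the ratio is inherited from the ancestor at level c. *)
Lemma partial_est_ratio_below c x d (le_cd : (c <= d)%N) (v : node n d) :
    (c < D)%N ->
  partial_est a c.+1 x v = est_ratio c x (trunc le_cd v) * partial_est a c x v.
Proof.
move=> cD.
have base e (le_ce : (c <= e)%N) (u : node n e) : c = e ->
    partial_est a c.+1 x u = est_ratio c x (trunc le_ce u) * partial_est a c x u.
  by move=> ce; subst e; rewrite trunc_id partial_est_ratio_above.
elim: d le_cd v => [|d IHd] le_cd v.
  by apply: base; apply/eqP; rewrite -leqn0.
have [cd|dc] := leqP c d; last by apply: base; apply/eqP; rewrite eqn_leq le_cd.
rewrite !partial_estS (IHd cd) (trunc_trunc _ _ le_cd) -[LHS]mulrA; congr (_ * (_ * _)).
rewrite xplus_pred//; congr (_ / (_ + _)); apply: eq_bigr => u _.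
by rewrite xplus_pred.
Qed.

(** The weight of a node is shared exactly among its children, so the total is the same at each
    level. This is why the final bounds do not depend on the level. *)
Lemma sum_level_weight d : (d <= D)%N -> \sum_(v : node n d) a d = a 0%N.
Proof.
elim: d => [|d IHd] dD; last first.
  rewrite (big_level _ _ (leqnSn d)) -IHd ?(ltnW dD)//; apply: eq_bigr => v _.
  by rewrite sum_children a_children.
rewrite sumr_const card_dep_ffun; set s := image_mem _ _.
suff -> : s = [::] by [].
by apply: size0nil; rewrite size_map -cardE card_ord.
Qed.

End Bayes_estimator.

(** * Pointwise comparison of entropy losses *)

Section Loss.
Context (R : realType) (n : nat -> nat) (D : nat).
Context (n_gt0 : forall k, (1 <= k <= D)%N -> (0 < n k)%N).
Implicit Types f g lam : param R n D.

Lemma ln_le_subr1 (y : R) : 0 < y -> ln y <= y - 1.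
Proof. by move=> y0; rewrite -[in ln y](subrKC 1 y) le_ln1Dx// ltrBrDl addrN. Qed.

Lemma kl_ge0 (l q : R) : 0 < l -> 0 < q -> 0 <= l * (q / l - 1 - ln (q / l)).
Proof.
by move=> l0 q0; rewrite mulr_ge0 ?(ltW l0)// subr_ge0 ln_le_subr1 ?divr_gt0.
Qed.

(** The right side minus the left side equals l (y - 1 - ln y) at y = p / q. *)
Lemma kl_compare (l p q : R) : 0 < l -> 0 < p -> 0 < q ->
  l * (q / l - 1 - ln (q / l)) + (p + l)
  <= l * (p / l - 1 - ln (p / l)) + (q + l * (p / q)).
Proof.
move=> l0 p0 q0; rewrite !ln_div ?posrE//.
have := ler_wpM2l (ltW l0) (ln_le_subr1 (divr_gt0 p0 q0)).
rewrite ln_div ?posrE// => h.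
have -> : l * (q / l - 1 - (ln q - ln l)) = q - l - l * ln q + l * ln l.
  by field; rewrite gt_eqF.
have -> : l * (p / l - 1 - (ln p - ln l)) = p - l - l * ln p + l * ln l.
  by field; rewrite gt_eqF.
by move: h; rewrite !mulrBr; lra.
Qed.

Lemma loss_ge0 g lam : positive lam ->
    (forall d (v : node n d), (d <= D)%N -> 0 < marginal g v) ->
  0 <= loss g lam.
Proof.
move=> lam_gt0 g_gt0; apply: sumr_ge0 => d _; apply: sumr_ge0 => v _.
have dD : (d <= D)%N by rewrite -ltnS.
by apply: kl_ge0; [exact: marginal_gt0 | exact: g_gt0].
Qed.

Lemma loss_compare f g lam : positive lam ->
    (forall d (v : node n d), (d <= D)%N -> 0 < marginal f v) ->
    (forall d (v : node n d), (d <= D)%N -> 0 < marginal g v) ->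
  loss g lam + \sum_(d < D.+1) \sum_(v : node n d) (marginal f v + marginal lam v)
  <= loss f lam + \sum_(d < D.+1) \sum_(v : node n d)
       (marginal g v + marginal lam v * (marginal f v / marginal g v)).
Proof.
move=> lam_gt0 f_gt0 g_gt0; rewrite -!big_split; apply: ler_sum => d _.
rewrite -!big_split; apply: ler_sum => v _; have dD : (d <= D)%N by rewrite -ltnS.
by apply: kl_compare; [exact: marginal_gt0 | exact: f_gt0 | exact: g_gt0].
Qed.

Lemma loss_self lam : positive lam -> loss lam lam = 0.
Proof.
move=> lam_gt0; rewrite /loss big1// => d _; rewrite big1// => v _.
rewrite divff ?ln1 ?subrr ?subr0 ?mulr0// gt_eqF// marginal_gt0//.
by rewrite -ltnS.
Qed.

End Loss.

(** * Comparison and finiteness of the risks *)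

Lemma lt_EFin_fine (R : realType) (x : \bar R) (c : R) :
  (0 <= x)%E -> (x < c%:E)%E -> x = (fine x)%:E /\ fine x < c.
Proof. by case: x => [r| |]//; rewrite lte_fin. Qed.

(** Finiteness of [y] permits the cancellation and then forces [x] to be finite as well. *)
Lemma lt_of_balance (R : realType) (x y : \bar R) (p q : R) : q < p ->
  (0 <= x)%E -> (0 <= y)%E -> (y < +oo)%E -> (x + p%:E <= y + q%:E)%E ->
  (x < y)%E.
Proof.
by case: x y => [x| |] [y| |]// qp _ _ _; rewrite !lee_fin lte_fin; lra.
Qed.

Section Risk.
Context (disp : measure_display) (T : measurableType disp) (R : realType).
Context (n : nat -> nat) (D : nat) (P : param R n D -> probability T R).
Context (X : forall d : 'I_D.+1, node n d -> {mfun T >-> nat}).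
Context (n_gt0 : forall k, (1 <= k <= D)%N -> (0 < n k)%N).
Context (model : poisson_model P X).
Context (a : nat -> R).
Context (a_gt0 : forall d, (d <= D)%N -> 0 < a d).
Context (a_children : forall d, (d < D)%N -> (n d.+1)%:R * a d.+1 = a d).
Context (a_ge1 : forall d, (d < D)%N -> 1 <= a d).
Context (lam : param R n D) (lam_gt0 : positive lam).

Local Notation Y := (fun k : node_index n D => X (tagged k)).
Local Notation E := (mean (P lam) Y).
Local Notation est D' z := (bayes_est a D' (data_of z)).
Local Notation lambda := (\sum_i lam i).

Lemma risk_mean D' :
  risk P X (bayes_est a D') lam = E (fun z => loss (est D' z) lam).
Proof.
rewrite /risk unlock /mean; apply: eq_integral => w _; congr (_%:E).
congr loss; congr bayes_est; apply: functional_extensionality_dep => d.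
by apply/funext => v; rewrite /data_of ffunE.
Qed.

Let mu_gt0 (k : node_index n D) : 0 < marginal lam (tagged k).
Proof. by rewrite marginal_gt0// -ltnS. Qed.

Let Yindep : mutually_independent (P lam) (fun k => Y k : T -> nat).
Proof. exact: (model lam_gt0).1. Qed.

Let Ypoisson (k : node_index n D) j :
  P lam (Y k @^-1` [set j]) = (poisson_pmf (marginal lam (tagged k)) j)%:E.
Proof. exact: (model lam_gt0).2. Qed.

Lemma mean_xplus D' d (v : node n d) : (d <= D')%N ->
  E (fun z => (xplus D' (data_of z) v)%:R)
  = ((D.+1 - D')%:R * marginal lam v)%:E.
Proof.
move=> dD'; under [X in mean _ _ X]eq_fun do rewrite xplus_observed.
by rewrite (mean_count mu_gt0 Yindep Ypoisson) sum_observed.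
Qed.

(** Every level sum equals the root marginal, which telescopes to (N + a_0) / m with E[N] = m
    lambda. *)
Lemma mean_est_level D' d : (D' <= D)%N -> (d <= D)%N ->
  E (fun z => \sum_(v : node n d) marginal (est D' z) v)
  = (lambda + a 0%N / (D.+1 - D')%:R)%:E.
Proof.
move=> D'D dD; have [v0] := node_inhabited n_gt0 (leq0n D).
have m_gt0 : 0 < (D.+1 - D')%:R :> R by rewrite ltr0n subn_gt0.
have m_ge0 := ltW m_gt0; have a0_ge0 := ltW (a_gt0 (leq0n D)).
transitivity (E (fun z => (D.+1 - D')%:R^-1 * (xplus D' (data_of z) v0)%:R
                          + (D.+1 - D')%:R^-1 * a 0%N)).
  congr mean; apply/funext => z; rewrite marginal_level// -(marginal_root _ v0).
  rewrite marginal_bayes_est// partial_est_telescope// add1n -mulrDr.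
  by rewrite mulrC.
rewrite meanD; last 2 first.
- by move=> z; rewrite mulr_ge0 ?invr_ge0.
- by move=> _; rewrite mulr_ge0 ?invr_ge0.
rewrite mean_cst meanZ ?invr_ge0// mean_xplus// marginal_root -EFinM -EFinD.
by congr (_%:E); rewrite mulKf ?gt_eqF// [in LHS](mulrC _ (a 0%N)).
Qed.

Lemma est_ratio_ge0 c x d (v : node n d) : (d <= D)%N ->
  0 <= est_ratio (R := R) (D := D) a c x v.
Proof.
move=> dD; rewrite /est_ratio mulr_ge0 ?divr_ge0 ?addr_ge0//.
all: by rewrite ltW// a_gt0.
Qed.

(** This is the ratio bound with alpha = (D - c) lambda_v and beta = (D + 1 - c) lambda_v, so that
    beta - alpha = lambda_v, rescaled by beta / alpha. *)
Lemma mean_est_ratio c d (v : node n d) : (d <= c)%N -> (c < D)%N ->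
  (E (fun z => est_ratio a c (data_of z) v)
   < (1 + a d / ((D - c)%:R * (D.+1 - c)%:R * marginal lam v))%:E)%E.
Proof.
move=> dc cD; have dD := leq_trans dc (ltnW cD).
have l_gt0 := marginal_gt0 v n_gt0 lam_gt0 dD.
have m_gt0 : 0 < (D - c)%:R :> R by rewrite ltr0n subn_gt0.
have m1_eq : (D.+1 - c)%:R = (D - c)%:R + 1 :> R.
  by rewrite subSn ?(ltnW cD)// -natr1.
have eA : \sum_(k in observed D c.+1 v) marginal lam (tagged k)
          = (D - c)%:R * marginal lam v.
  by rewrite sum_observed ?leqW// subSS.
have eB := sum_observed lam v dc.
have := mean_ratio_lt mu_gt0 Yindep Ypoisson (observedS D c v) eA eB
  (a_ge1 (leq_ltn_trans dc cD)).
rewrite m1_eq ltr_pM2r// ltrDl => /(_ ltr01) lt_ratio.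
under [X in mean _ _ X]eq_fun do rewrite /est_ratio !xplus_observed.
rewrite meanZ ?divr_ge0//; last by move=> z; rewrite divr_ge0 ?addr_ge0// ltW ?a_gt0.
have k_gt0 : 0 < (1 + D - c)%:R / (D - c)%:R :> R.
  by rewrite divr_gt0// add1n m1_eq addr_gt0.
rewrite -lte_pdivlMl// -EFinM; apply: lt_le_trans lt_ratio _; rewrite lee_fin.
rewrite add1n m1_eq le_eqVlt; apply/orP; left; apply/eqP; field.
by rewrite !gt_eqF// addr_gt0.
Qed.

(** Here [e] is the level at which the ratio is read. Grouping level d by ancestors at level [e]
    cancels lambda_w against the denominator of the ratio bound, and the weights a_e then add up to
    a_0. *)
Lemma mean_level_lt c d e (le_ed : (e <= d)%N) :
    (e <= c)%N -> (c < D)%N -> (d <= D)%N ->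
    (forall (x : data n D) (v : node n d), partial_est a c.+1 x v
      = est_ratio a c x (trunc le_ed v) * partial_est a c x v) ->
  (E (fun z => (\sum_(v : node n d) (marginal (est c z) v
       + marginal lam v * (marginal (est c.+1 z) v / marginal (est c z) v)))%R)
   < (2 * lambda + a 0%N / (D - c)%:R)%:E)%E.
Proof.
move=> ec cD dD ratioE; have cD' := ltnW cD; have eD := leq_trans ec cD'.
have m_gt0 : 0 < (D - c)%:R :> R by rewrite ltr0n subn_gt0.
have m1_eq : (D.+1 - c)%:R = (D - c)%:R + 1 :> R by rewrite subSn// -natr1.
have est_gt0 (z : {ffun node_index n D -> nat}) (v : node n d) : 0 < marginal (est c z) v.
  by rewrite marginal_bayes_est// partial_est_gt0.
have lam_v_gt0 (v : node n d) : 0 < marginal lam v by exact: marginal_gt0.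
under [X in mean _ _ X]eq_fun => z.
  under eq_bigr => v _.
    rewrite (marginal_bayes_est a_gt0 a_children c.+1)// ratioE.
    rewrite -(marginal_bayes_est a_gt0 a_children c)//.
    rewrite mulfK ?gt_eqF//; over.
  rewrite big_split /=; over.
rewrite meanD; last 2 first.
- by move=> z; apply: sumr_ge0 => v _; exact: ltW.
- by move=> z; apply: sumr_ge0 => v _; rewrite mulr_ge0 ?est_ratio_ge0// ltW.
rewrite mean_est_level// mean_sum => [|v z _]; last first.
  by rewrite mulr_ge0 ?est_ratio_ge0// ltW.
pose r (w : node n e) := fine (E (fun z => est_ratio a c (data_of z) w)).
have r_eq w : E (fun z => est_ratio a c (data_of z) w) = (r w)%:E /\
    r w < 1 + a e / ((D - c)%:R * (D.+1 - c)%:R * marginal lam w).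
  apply: lt_EFin_fine; last exact: mean_est_ratio.
  by apply: mean_ge0 => z; exact: est_ratio_ge0.
rewrite (eq_bigr (fun v => (marginal lam v * r (trunc le_ed v))%:E)); last first.
  move=> v _; rewrite meanZ ?(ltW (lam_v_gt0 v)) ?(r_eq _).1//.
  by move=> z; exact: est_ratio_ge0.
rewrite sumEFin -EFinD lte_fin.
have has_node : has xpredT (index_enum (node n d)).
  by have [v0] := node_inhabited n_gt0 dD; apply/hasP; exists v0.
have sum_lt : \sum_(v : node n d) marginal lam v * r (trunc le_ed v) <
    \sum_(v : node n d) marginal lam v * (1 + a e /
      ((D - c)%:R * (D.+1 - c)%:R * marginal lam (trunc le_ed v))).
  by apply: ltr_sum => // v _; rewrite ltr_pM2l// (r_eq _).2.
suff -> : 2 * lambda + a 0%N / (D - c)%:R = lambda + a 0%N / (D.+1 - c)%:R +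
    \sum_(v : node n d) marginal lam v * (1 + a e /
      ((D - c)%:R * (D.+1 - c)%:R * marginal lam (trunc le_ed v))).
  by rewrite ltrD2l.
under [X in _ = _ + X]eq_bigr do rewrite mulrDr mulr1.
rewrite big_split /= marginal_level// (big_level _ _ le_ed).
transitivity (lambda + a 0%N / (D.+1 - c)%:R +
  (lambda + \sum_(w : node n e) a e / ((D - c)%:R * (D.+1 - c)%:R))).
  (* With m = D - c, this uses a_0 / (m + 1) + a_0 / (m (m + 1)) = a_0 / m. *)
  rewrite -mulr_suml (sum_level_weight a_children)// m1_eq; field.
  by rewrite !gt_eqF// addr_gt0.
congr (_ + (_ + _)); apply: eq_bigr => w _.
under eq_bigr => v.
  by rewrite (extendsE le_ed) => /eqP ->; over.
rewrite -mulr_suml marginal_sum ?le_ed// m1_eq; field.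
by rewrite !gt_eqF// ?addr_gt0// marginal_gt0.
Qed.

Lemma mean_level_ref c d : (c < D)%N -> (d <= D)%N ->
  E (fun z => \sum_(v : node n d) (marginal (est c.+1 z) v + marginal lam v))
  = (2 * lambda + a 0%N / (D - c)%:R)%:E.
Proof.
move=> cD dD; under [X in mean _ _ X]eq_fun do rewrite big_split /=.
have lam_level_ge0 : 0 <= \sum_(v : node n d) marginal lam v.
  by apply: sumr_ge0 => v _; rewrite ltW// marginal_gt0.
rewrite meanD//; last first.
  by move=> z; apply: sumr_ge0 => v _; rewrite marginal_bayes_est// ltW// partial_est_gt0.
rewrite mean_est_level// mean_cst -EFinD subSS marginal_level//.
by congr (_%:E); ring.
Qed.

(** The loss comparison is integrated with the estimators based on X(c + 1) and X(c). At each level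
    the extra sum [q] has mean strictly below s, which is exactly the mean of [p]. *)
Lemma risk_lt_succ c : (c < D)%N ->
  (risk P X (bayes_est a c.+1) lam < +oo)%E ->
  (risk P X (bayes_est a c) lam < risk P X (bayes_est a c.+1) lam)%E.
Proof.
move=> cD; have cD' := ltnW cD; rewrite !risk_mean => fin_risk.
have est_gt0 D' (z : {ffun node_index n D -> nat}) d (v : node n d) :
    (D' <= D)%N -> (d <= D)%N -> 0 < marginal (est D' z) v.
  by move=> *; rewrite marginal_bayes_est// partial_est_gt0.
have loss_est_ge0 D' (z : {ffun node_index n D -> nat}) : (D' <= D)%N ->
    0 <= loss (est D' z) lam.
  by move=> D'D; apply: loss_ge0 => // d v; exact: est_gt0.
pose s := 2 * lambda + a 0%N / (D - c)%:R.
pose p (d : 'I_D.+1) (z : {ffun node_index n D -> nat}) :=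
  \sum_(v : node n d) (marginal (est c.+1 z) v + marginal lam v).
pose q (d : 'I_D.+1) (z : {ffun node_index n D -> nat}) :=
  \sum_(v : node n d) (marginal (est c z) v
    + marginal lam v * (marginal (est c.+1 z) v / marginal (est c z) v)).
have p_ge0 d z : 0 <= p d z.
  have dD : (d <= D)%N by rewrite -ltnS.
  by apply: sumr_ge0 => v _; rewrite ltW// addr_gt0 ?est_gt0 ?marginal_gt0.
have q_ge0 d z : 0 <= q d z.
  have dD : (d <= D)%N by rewrite -ltnS.
  apply: sumr_ge0 => v _; rewrite ltW// addr_gt0 ?est_gt0// mulr_gt0 ?marginal_gt0//.
  by rewrite divr_gt0 ?est_gt0.
have Ep : E (fun z => \sum_(d < D.+1) p d z) = (\sum_(d < D.+1) s)%:E.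
  rewrite mean_sum => [|i z _]; last exact: p_ge0.
  rewrite -sumEFin; apply: eq_bigr => d _.
  by apply: mean_level_ref => //; rewrite -ltnS.
have Eq_lt d : E (q d) = (fine (E (q d)))%:E /\ fine (E (q d)) < s.
  apply: lt_EFin_fine; first exact: mean_ge0.
  have dD : (d <= D)%N by rewrite -ltnS.
  (* The ratio is read at the node itself for d <= c, and at its ancestor of level c for deeper
     d. *)
  have [dc|/ltnW cd] := leqP d c.
    have := mean_level_lt (le_ed := leqnn d) dc cD dD; apply => x v.
    by rewrite trunc_id partial_est_ratio_above.
  have := mean_level_lt (le_ed := cd) (leqnn c) cD dD; apply => x v.
  exact: partial_est_ratio_below.
have Eq : E (fun z => \sum_(d < D.+1) q d z)
    = (\sum_(d < D.+1) fine (E (q d)))%:E.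
  rewrite mean_sum => [|i z _]; last exact: q_ge0.
  by rewrite -sumEFin; apply: eq_bigr => d _; exact: (Eq_lt d).1.
have sum_lt : \sum_(d < D.+1) fine (E (q d)) < \sum_(d < D.+1) s.
  apply: ltr_sum => [|d _]; last exact: (Eq_lt d).2.
  by apply/hasP; exists ord0.
have loss_c_ge0 z := loss_est_ge0 c z cD'.
have loss_c1_ge0 z := loss_est_ge0 c.+1 z cD.
apply: lt_of_balance sum_lt _ _ _ _ => //; [exact: mean_ge0 | exact: mean_ge0 |].
have sp_ge0 z : 0 <= \sum_(d < D.+1) p d z by exact: sumr_ge0.
have sq_ge0 z : 0 <= \sum_(d < D.+1) q d z by exact: sumr_ge0.
rewrite -Ep -Eq -(meanD _ _ loss_c_ge0 sp_ge0) -(meanD _ _ loss_c1_ge0 sq_ge0).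
apply: le_mean => z; first exact: addr_ge0.
by apply: loss_compare => // d v dD; exact: est_gt0.
Qed.

(** With D' = D the estimated marginals telescope at every level with divisor 1, hence are at least
    a_d. Comparison with the zero loss of [lam] itself bounds the loss by the sum of delta_v +
    lambda_v^2 / a_d, which has finite mean. *)
Lemma risk_leaf_fin : (risk P X (bayes_est a D) lam < +oo)%E.
Proof.
have est_ge (z : {ffun node_index n D -> nat}) d (v : node n d) : (d <= D)%N ->
    a d <= marginal (est D z) v.
  move=> dD; rewrite marginal_bayes_est// partial_est_telescope//.
  by rewrite addnK divr1 lerDr.
have est_gt0 (z : {ffun node_index n D -> nat}) d (v : node n d) : (d <= D)%N ->
    0 < marginal (est D z) v.
  by move=> dD; apply: lt_le_trans (est_ge z d v dD); exact: a_gt0.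
pose b d := \sum_(v : node n d) marginal lam v * (marginal lam v / a d).
have b_ge0 (d : 'I_D.+1) : 0 <= b d.
  have dD : (d <= D)%N by rewrite -ltnS.
  by apply: sumr_ge0 => v _; rewrite mulr_ge0 ?divr_ge0// ltW// ?marginal_gt0 ?a_gt0.
have level_ge0 (d : 'I_D.+1) (z : {ffun node_index n D -> nat}) :
    0 <= \sum_(v : node n d) marginal (est D z) v.
  by apply: sumr_ge0 => v _; rewrite ltW// est_gt0// -ltnS.
rewrite risk_mean; apply: (@le_lt_trans _ _ (E (fun z =>
    \sum_(d < D.+1) (\sum_(v : node n d) marginal (est D z) v + b d)))).
  apply: le_mean => z; first by apply: loss_ge0 => // d v; exact: est_gt0.
  have := loss_compare n_gt0 lam_gt0 (f := lam) (g := est D z)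
    (fun d v => marginal_gt0 v n_gt0 lam_gt0) (est_gt0 z).
  rewrite loss_self// add0r => h.
  apply: (le_trans _ (le_trans h _)).
    rewrite lerDl; apply: sumr_ge0 => d _; apply: sumr_ge0 => v _.
    by rewrite addr_ge0// ltW// marginal_gt0// -ltnS.
  apply: ler_sum => d _; rewrite big_split lerD2l; apply: ler_sum => v _.
  have dD : (d <= D)%N by rewrite -ltnS.
  have l_gt0 := marginal_gt0 v n_gt0 lam_gt0 dD.
  by rewrite !ler_pM2l// lef_pV2 ?posrE ?est_ge ?est_gt0 ?a_gt0.
rewrite mean_sum => [|i z _]; last exact: addr_ge0.
rewrite (eq_bigr (fun d : 'I_D.+1 =>
    (lambda + a 0%N / (D.+1 - D)%:R + b d)%:E)) ?sumEFin ?ltry// => d _.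
have dD : (d <= D)%N by rewrite -ltnS.
by rewrite (meanD _ _ (level_ge0 d) (fun=> b_ge0 d)) mean_est_level// mean_cst.
Qed.

(** Descending induction from D: a finite risk at one level makes the next smaller one finite, being
    strictly below it. *)
Lemma risk_fin c : (c <= D)%N -> (risk P X (bayes_est a c) lam < +oo)%E.
Proof.
move=> cD; rewrite -(subKn cD); move: (D - c)%N (leq_subr c D) => k.
elim: k => [_|k IHk kD]; first by rewrite subn0; exact: risk_leaf_fin.
have DkS : (D - k = (D - k.+1).+1)%N by rewrite -subSn.
have fin_k := IHk (ltnW kD); apply: lt_trans fin_k.
by rewrite DkS; apply: risk_lt_succ; rewrite -DkS ?leq_subr ?IHk// ltnW.
Qed.

Lemma risk_decreasing c d : (c < d)%N -> (d <= D)%N ->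
  (risk P X (bayes_est a c) lam < risk P X (bayes_est a d) lam)%E.
Proof.
elim: d => // d IHd; rewrite ltnS leq_eqVlt => /predU1P[->|cd] dD.
  by apply: risk_lt_succ => //; exact: risk_fin.
apply: lt_trans (IHd cd (ltnW dD)) _.
by apply: risk_lt_succ => //; exact: risk_fin.
Qed.

End Risk.

(** * The Jeffreys hyperparameters and the domination *)

Section Jeffreys.
Context (R : realType) (n : nat -> nat) (D : nat).

(** For D' = D_0 the indicator is always 1, since every e satisfies e <= D_0 or D_0 < e. *)
Lemma hyper_jeffreys D0 : hyper R n D D0 D0 = jeffreys R n D.
Proof.
apply/funext => d; rewrite /hyper /jeffreys natr_prod.
case: ifP => _; rewrite mulrC//; congr (_ / _); apply: eq_bigr => e _.
by rewrite ltnNge orbN expr1.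
Qed.

Lemma jeffreys_gt0 d : (forall k, (1 <= k <= D)%N -> (0 < n k)%N) ->
  0 < jeffreys R n D d.
Proof.
move=> n_gt0; rewrite divr_gt0// ltr0n big_nat prodn_cond_gt0// => e /andP[de eD].
by rewrite n_gt0// (leq_trans _ de).
Qed.

Lemma jeffreys_children d : (d < D)%N ->
  (n d.+1)%:R * jeffreys R n D d.+1 = jeffreys R n D d.
Proof. by move=> dD; rewrite /jeffreys [in RHS]big_ltn// natrM mulrA. Qed.

(** For d < D the product contains the factor n_D >= 2. The leaf value is only 1/2, but ratios are
    read at levels at most c < D. *)
Lemma jeffreys_ge1 d : (forall k, (1 <= k <= D)%N -> (0 < n k)%N) ->
  (2 <= n D)%N -> (d < D)%N -> 1 <= jeffreys R n D d.
Proof.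
move=> n_gt0 nD dD; rewrite /jeffreys ler_pdivlMr// mul1r ler_nat.
rewrite big_nat_recr//= (leq_trans nD)// leq_pmull//.
rewrite big_nat prodn_cond_gt0// => e /andP[de eD].
by rewrite n_gt0// (leq_trans _ de)// ltnW.
Qed.

End Jeffreys.

Theorem theorem4p1 (R : realType) (D : nat) (n : nat -> nat)
    (disp : measure_display) (T : measurableType disp)
    (P : param R n D -> probability T R)
    (X : forall d : 'I_D.+1, node n d -> {mfun T >-> nat})
    (D0 : nat)
    (hn : forall d : nat, (1 <= d <= D)%N -> (0 < n d)%N)
    (hmodel : poisson_model P X)
    (hD0 : (1 <= D0 <= D)%N)
    (hnD : (2 <= n D)%N) :
  (forall D' : nat, (1 <= D' <= D)%N ->
     dominated P X (bayes_est (hyper R n D D0 D0) D')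
                   (bayes_est (hyper R n D D0 D0) D'.-1)) /\
  dominated P X (bayes_est (jeffreys R n D) D) (bayes_est (jeffreys R n D) 0).
Proof.
have dom c d : (c < d)%N -> (d <= D)%N ->
    dominated P X (bayes_est (jeffreys R n D) d) (bayes_est (jeffreys R n D) c).
  move=> cd dD; have lt_risk lam : positive lam ->
      (risk P X (bayes_est (jeffreys R n D) c) lam
       < risk P X (bayes_est (jeffreys R n D) d) lam)%E.
    move=> lam_gt0; apply: risk_decreasing => // k kD.
    - exact: jeffreys_gt0.
    - exact: jeffreys_children.
    - exact: jeffreys_ge1.
  split=> [lam lam_gt0|]; first by rewrite ltW// lt_risk.
  (* The inequality is strict at every positive parameter, so any witness serves; the constant 1 is
     taken. *)
  have one_gt0 : positive (fun _ : node n D => 1 : R) by move=> i; exact: ltr01.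
  by exists (fun=> 1); [|exact: lt_risk].
rewrite hyper_jeffreys; case/andP: hD0 => D0_gt0 D0D.
split=> [[|D'] // D'D|]; last by apply: dom => //; exact: leq_trans D0D.
exact: dom.
Qed.
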